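(* Let $B=(G,T)$ be a B-ESG grammar. Then every graph in the language $L(B)$ is a string graph.
   Context: Graphs: a graph over a vertex-label alphabet $\Sigma$ and edge-label alphabet $\Gamma$ is $H=(V,E,\lambda)$ with $V$ finite, $E\subseteq\{(v,\gamma,w): v,w\in V, v\neq w, \gamma\in\Gamma\}$ (directed labelled edges, no self-loops) and $\lambda:V\to\Sigma$. A graph with embedding is a pair $(D,C)$ with $D$ a graph and $C\subseteq \Sigma\times\Gamma\times\Gamma\times V_D\times\{in,out\}$; its elements (connection instructions) are written $(\sigma,\beta/\gamma,x,d)$. An edNCE grammar is $G=(\Sigma,\Delta,\Gamma,\Omega,P,S)$ with terminal vertex labels $\Delta\subseteq\Sigma$, final edge labels $\Omega\subseteq\Gamma$, a finite set $P$ of productions $X\to(D,C)$ with $X\in\Sigma\setminus\Delta$ and $(D,C)$ a graph with embedding, and initial non-terminal $S\in\Sigma\setminus\Delta$. Applying a production $X\to(D,C)$ to a vertex $v$ labelled $X$ of a graph $H$: delete $v$ and its incident edges, add a disjoint copy of $D$, and for every $\beta$-labelled edge between $v$ and a vertex $w$ with label $\sigma$ which is directed into $v$ (case $d=in$) or out of $v$ (case $d=out$), and every instruction $(\sigma,\beta/\gamma,x,d)\in C$, add a $\gamma$-labelled edge between $w$ and (the copy of) $x$, directed from $w$ to $x$ if $d=in$ and from $x$ to $w$ if $d=out$. A derivation starts from the graph with a single vertex labelled $S$ and applies productions. The grammar is B-edNCE (boundary) if for every production $X\to(D,C)$, $D$ contains no two adjacent non-terminal vertices and $C$ contains no instruction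 $(\sigma,\beta/\gamma,x,d)$ with $\sigma$ a non-terminal label. String graphs: fix disjoint label sets $\mathcal N$ (node-vertex labels) and $\mathcal W$ (wire-vertex labels). A (directed) string graph is a directed graph with vertex labels in $\mathcal N\cup\mathcal W$ such that (1) no edge connects two node-vertices, (2) every wire-vertex has in-degree at most one and (3) out-degree at most one. Fix a finite set $\mathcal E$ of encoding symbols. An encoded string graph is a string graph in which, additionally, edges labelled by encoding symbols may connect pairs of node-vertices. A decoding system $T$ is a set of double-pushout rewrite rules, one for each triple $(\alpha,N_1,N_2)\in\mathcal E\times\mathcal N\times\mathcal N$, whose left-hand side is a single $\alpha$-labelled edge from an $N_1$-labelled node-vertex to an $N_2$-labelled node-vertex, whose interface consists of these two node-vertices, and whose right-hand side is a connected string graph containing no inputs, outputs or encoding labels; decoding means rewriting with $T$ until no encoding edge remains. B-ESG grammar: a pair $B=(G,T)$ with $T$ a decoding system and $G=(\Sigma,\Delta,\Gamma,\Gamma,P,S)$ a B-edNCE grammar with $\Delta=\mathcal N\cup\mathcal W$ and $\mathcal E\subseteq\Gamma$ (edges with label in $\mathcal E$ are encoding edges), such that for every production $X\to(D,C)\in P$: (N1) an edge of $D$ carries an encoding label iff it connects two node-vertices; (N2) every instruction $(N,\alpha/\beta,x,d)$ with $N\in\mathcal N$ and $x$ a node-vertex has $\beta\in\mathcal E$; (W1) every wire-vertex in $D$ has in-degree and out-degree at most one; (W2) there is no instruction $(\sigma,\alpha/\beta,x,d)$ with $x$ a wire-vertex; (W3) for each $W\in\mathcal W$ and each $\gamma,d$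 there is at most one instruction of the form $(W,\gamma/\delta,x,d)$, and it has $\delta\notin\mathcal E$; (W4) if a non-terminal vertex $y$ of $D$ with label $Y$ is adjacent to a $W$-labelled wire-vertex via an edge with direction $d$ and label $\beta$, or there is an instruction $(W,\alpha/\beta,y,d)$, then every production for $Y$ contains an instruction of the form $(W,\beta/\gamma,z,d)$. A concrete derivation is a derivation $S\Rightarrow^G_* H_1$ in $G$ with $H_1$ containing no non-terminals, followed by decoding $H_1\Rightarrow^T_* H_2$; $L(B)$ is the set of all such $H_2$. *)

(* Defs.v *)
From HB Require Import structures.
From mathcomp Require Import all_boot.
From Stdlib Require Import Relation_Operators.

Set Implicit Arguments.
Unset Strict Implicit.
Unset Printing Implicit Defensive.

(** An edge [(v, g, w)] is directed from [v] to [w] and labelled [g]. *)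
Record graph (Sigma Gamma : finType) := Graph {
  vertex : finType;
  edges : {set vertex * Gamma * vertex};
  lab : vertex -> Sigma;
  loopless : forall v g w, (v, g, w) \in edges -> v != w }.

Arguments edges {Sigma Gamma} _.
Arguments lab {Sigma Gamma} _.

Section GraphNotions.
Variables Sigma Gamma : finType.
Implicit Types H K : graph Sigma Gamma.

Definition adjacent H (v w : vertex H) : bool :=
  [exists g, ((v, g, w) \in edges H) || ((w, g, v) \in edges H)].

Definition connected H : Prop := forall v w : vertex H, connect (@adjacent H) v w.

Definition indeg H (v : vertex H) : nat := #|[set e in edges H | e.2 == v]|.
Definition outdeg H (v : vertex H) : nat := #|[set e in edges H | e.1.1 == v]|.

Definition graph_iso H K : Prop :=
  exists2 f : vertex H -> vertex K, bijective f &
    (forall v, lab K (f v) = lab H v) /\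
    (forall v g w, ((f v, g, f w) \in edges K) = ((v, g, w) \in edges H)).

Definition graph_mor H K (f : vertex H -> vertex K) : Prop :=
  (forall v, lab K (f v) = lab H v) /\
  (forall v g w, (v, g, w) \in edges H -> (f v, g, f w) \in edges K).

Definition graph_mono H K (f : vertex H -> vertex K) : Prop :=
  graph_mor f /\ injective f.

End GraphNotions.

Arguments graph_mor {Sigma Gamma H K} f.
Arguments graph_mono {Sigma Gamma H K} f.
Arguments adjacent {Sigma Gamma H} v w.
Arguments indeg {Sigma Gamma H} v.
Arguments outdeg {Sigma Gamma H} v.

Section SingletonGraph.
Variables (Sigma Gamma : finType) (s : Sigma).

Lemma single_loopless v g w :
  (v, g, w) \in (set0 : {set unit * Gamma * unit}) -> v != w.
Proof. by rewrite inE. Qed.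

Definition single_graph : graph Sigma Gamma :=
  @Graph Sigma Gamma unit set0 (fun=> s) single_loopless.

End SingletonGraph.

Inductive dir := In | Out.

Definition dir_is_in (d : dir) : bool := if d is In then true else false.
Definition dir_of_bool (b : bool) : dir := if b then In else Out.
Lemma dir_is_inK : cancel dir_is_in dir_of_bool. Proof. by case. Qed.
HB.instance Definition _ := Finite.copy dir (can_type dir_is_inK).

(** The element [(s, b, c, x, d)] of [instr] is the instruction
    [(s, b/c, x, d)]. *)
Record production (Sigma Gamma : finType) := Production {
  lhs : Sigma;
  rhs : graph Sigma Gamma;
  instr : {set Sigma * Gamma * Gamma * vertex rhs * dir} }.

Arguments instr {Sigma Gamma} _.

(** The finite set of productions is a family over a finite index type. *)
Record edNCE (Sigma Gamma : finType) := EdNCE {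
  terminals : {set Sigma};
  final_edges : {set Gamma};
  prod_index : finType;
  prods : prod_index -> production Sigma Gamma;
  start : Sigma;
  lhs_nonterminal : forall p, lhs (prods p) \notin terminals;
  start_nonterminal : start \notin terminals }.

Arguments prods {Sigma Gamma} _.

Section Derivation.
Variables Sigma Gamma : finType.

Section Substitution.
Variables (H : graph Sigma Gamma) (v : vertex H) (p : production Sigma Gamma).

Definition subst_vertex : finType := ({w : vertex H | w != v} + vertex (rhs p))%type.

Definition subst_lab (x : subst_vertex) : Sigma :=
  match x with inl w => lab H (val w) | inr x => lab (rhs p) x end.

Definition subst_edge (e : subst_vertex * Gamma * subst_vertex) : bool :=
  match e with
  | (inl w, c, inl u) => (val w, c, val u) \in edges H
  | (inr x, c, inr y) => (x, c, y) \in edges (rhs p)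
  | (inl w, c, inr x) =>
      [exists b, ((val w, b, v) \in edges H) &&
                 ((lab H (val w), b, c, x, In) \in instr p)]
  | (inr x, c, inl w) =>
      [exists b, ((v, b, val w) \in edges H) &&
                 ((lab H (val w), b, c, x, Out) \in instr p)]
  end.

Lemma subst_loopless x c y : (x, c, y) \in [set e | subst_edge e] -> x != y.
Proof.
rewrite inE; case: x y => [w|x] [u|y] //= /loopless.
  by apply: contra_neq => -[->].
by apply: contra_neq => -[->].
Qed.

Definition substitute : graph Sigma Gamma :=
  @Graph Sigma Gamma subst_vertex [set e | subst_edge e] subst_lab subst_loopless.

End Substitution.

Definition derives_step (G : edNCE Sigma Gamma) (H H' : graph Sigma Gamma) : Prop :=
  exists (p : prod_index G) (v : vertex H),
    lab H v = lhs (prods G p) /\ graph_iso (substitute v (prods G p)) H'.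

Definition derives (G : edNCE Sigma Gamma) :=
  clos_refl_trans_1n (graph Sigma Gamma) (derives_step G).

Definition boundary (G : edNCE Sigma Gamma) : Prop :=
  forall p : prod_index G,
    (forall x y : vertex (rhs (prods G p)),
       lab _ x \notin terminals G -> lab _ y \notin terminals G -> ~~ adjacent x y) /\
    (forall s b c x d, (s, b, c, x, d) \in instr (prods G p) -> s \in terminals G).

End Derivation.

Section DPO.
Variables Sigma Gamma : finType.
Implicit Types H I K L R : graph Sigma Gamma.

(** [H] is obtained by gluing [K] and [L] along their common subgraph [I]: the
    square is commutative and is a pushout, along monomorphisms, of both the
    vertex sets and the edge sets.  The last clause matters because edges form
    a set of triples: without it an edge could be in [K] and also in [L]
    outside [I], and so survive its own deletion. *)
Record pushout I K L H
    (iK : vertex I -> vertex K) (iL : vertex I -> vertex L)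
    (jK : vertex K -> vertex H) (jL : vertex L -> vertex H) : Prop := Pushout {
  po_iK : graph_mono iK;
  po_iL : graph_mono iL;
  po_jK : graph_mono jK;
  po_jL : graph_mono jL;
  po_comm : forall z, jK (iK z) = jL (iL z);
  po_vertex : forall v, (exists x, v = jK x) \/ (exists y, v = jL y);
  po_vertex_meet : forall x y, jK x = jL y -> exists z, x = iK z /\ y = iL z;
  po_edge : forall v g w, (v, g, w) \in edges H ->
    (exists x x', (x, g, x') \in edges K /\ (v = jK x /\ w = jK x')) \/
    (exists y y', (y, g, y') \in edges L /\ (v = jL y /\ w = jL y'));
  po_edge_meet : forall x g x' y y',
    (x, g, x') \in edges K -> (y, g, y') \in edges L -> jK x = jL y -> jK x' = jL y' ->
    exists z z', [/\ (z, g, z') \in edges I, x = iK z, x' = iK z', y = iL z & y' = iL z'] }.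

Lemma pushout_universal I K L H iK iL jK jL :
  @pushout I K L H iK iL jK jL ->
  forall (X : graph Sigma Gamma) (hK : vertex K -> vertex X) (hL : vertex L -> vertex X),
  graph_mor hK -> graph_mor hL -> (forall z, hK (iK z) = hL (iL z)) ->
  exists u : vertex H -> vertex X,
    [/\ graph_mor u, forall x, u (jK x) = hK x, forall y, u (jL y) = hL y &
        forall u' : vertex H -> vertex X,
          (forall x, u' (jK x) = hK x) -> (forall y, u' (jL y) = hL y) -> u' =1 u].
Proof.
move=> po X hK hL [hKl hKe] [hLl hLe] hI.
have [[jKl jKe] jKi] := po_jK po; have [[jLl jLe] jLi] := po_jL po.
have hJ x y : jK x = jL y -> hK x = hL y.
  by case/(po_vertex_meet po) => z [-> ->].
have ex v : exists t, (forall x, v = jK x -> t = hK x) /\ (forall y, v = jL y -> t = hL y).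
  case: (po_vertex po v) => -[x ->].
    by exists (hK x); split=> [x' /jKi -> //|y /hJ].
  by exists (hL x); split=> [x' /esym/hJ|y /jLi ->].
have ex' v : exists t, [forall x, (v == jK x) ==> (t == hK x)] &&
                       [forall y, (v == jL y) ==> (t == hL y)].
  have [t [t1 t2]] := ex v; exists t; apply/andP; split.
    by apply/forallP => x; apply/implyP => /eqP/t1 ->.
  by apply/forallP => x; apply/implyP => /eqP/t2 ->.
pose u v := xchoose (ex' v).
have uK x : u (jK x) = hK x.
  have /andP[/forallP/(_ x) + _] := xchooseP (ex' (jK x)).
  by rewrite eqxx => /eqP.
have uL y : u (jL y) = hL y.
  have /andP[_ /forallP/(_ y)] := xchooseP (ex' (jL y)).
  by rewrite eqxx => /eqP.
exists u; split => // [|u' u'K u'L v].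
  split=> [v|v g w].
    by case: (po_vertex po v) => -[x ->]; rewrite (uK, uL) (hKl, hLl) (jKl, jLl).
  case/(po_edge po) => -[x [x' [e [-> ->]]]]; rewrite !(uK, uL).
    exact: hKe.
  exact: hLe.
by case: (po_vertex po v) => -[x ->]; rewrite (uK, uL) (u'K, u'L).
Qed.

Record dpo_rule := DpoRule {
  dpo_lhs : graph Sigma Gamma;
  dpo_int : graph Sigma Gamma;
  dpo_rhs : graph Sigma Gamma;
  dpo_l : vertex dpo_int -> vertex dpo_lhs;
  dpo_r : vertex dpo_int -> vertex dpo_rhs;
  dpo_l_mono : graph_mono dpo_l;
  dpo_r_mono : graph_mono dpo_r }.

(** Matches [m] are injective.  For the single-edge left-hand sides of decoding
    rules this is automatic, graphs being loop-free. *)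
Definition dpo_step (r : dpo_rule) H H' : Prop :=
  exists (K : graph Sigma Gamma) (m : vertex (dpo_lhs r) -> vertex H)
         (m' : vertex (dpo_rhs r) -> vertex H')
         (k : vertex (dpo_int r) -> vertex K)
         (f : vertex K -> vertex H) (f' : vertex K -> vertex H'),
    pushout k (@dpo_l r) f m /\ pushout k (@dpo_r r) f' m'.

End DPO.

Arguments dpo_lhs {Sigma Gamma} _.
Arguments dpo_int {Sigma Gamma} _.
Arguments dpo_rhs {Sigma Gamma} _.

Section StringGraphs.
Variables (Sigma Gamma : finType) (N W : {set Sigma}) (E : {set Gamma}).
Implicit Type H : graph Sigma Gamma.

Definition is_node H (v : vertex H) : bool := lab H v \in N.
Definition is_wire H (v : vertex H) : bool := lab H v \in W.

Definition string_graph H : Prop :=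
  [/\ forall v, lab H v \in N :|: W,
      forall v g w, (v, g, w) \in edges H -> ~~ (is_node v && is_node w),
      forall v : vertex H, is_wire v -> indeg v <= 1 &
      forall v : vertex H, is_wire v -> outdeg v <= 1].

Definition is_input H (v : vertex H) : bool := is_wire v && (indeg v == 0).
Definition is_output H (v : vertex H) : bool := is_wire v && (outdeg v == 0).

Definition no_encoding_edge H : Prop :=
  forall v g w, (v, g, w) \in edges H -> g \notin E.

Definition decoding_rule (a : Gamma) (n1 n2 : Sigma) (r : dpo_rule Sigma Gamma) : Prop :=
  [/\ exists s t : vertex (dpo_lhs r),
        [/\ forall x, x = s \/ x = t, s != t, lab _ s = n1, lab _ t = n2 &
            edges (dpo_lhs r) = [set (s, a, t)]],
      (forall x, exists z, @dpo_l _ _ r z = x) /\ edges (dpo_int r) = set0,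
      string_graph (dpo_rhs r) /\ connected (dpo_rhs r),
      forall v : vertex (dpo_rhs r), ~~ is_input v /\ ~~ is_output v &
      no_encoding_edge (dpo_rhs r)].

(** Only the values at triples in [E * N * N] are rules of the system. *)
Definition decoding_family := Gamma -> Sigma -> Sigma -> dpo_rule Sigma Gamma.

Definition decoding_system (T : decoding_family) : Prop :=
  forall a n1 n2, a \in E -> n1 \in N -> n2 \in N -> decoding_rule a n1 n2 (T a n1 n2).

Definition decodes_step (T : decoding_family) H H' : Prop :=
  exists a n1 n2, [/\ a \in E, n1 \in N, n2 \in N & dpo_step (T a n1 n2) H H'].

Definition decodes (T : decoding_family) :=
  clos_refl_trans_1n (graph Sigma Gamma) (decodes_step T).

Section Conditions.
Variable G : edNCE Sigma Gamma.

Definition cond_N1 (p : production Sigma Gamma) : Prop :=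
  forall v g w, (v, g, w) \in edges (rhs p) -> (g \in E) = is_node v && is_node w.

Definition cond_N2 (p : production Sigma Gamma) : Prop :=
  forall n a b x d, (n, a, b, x, d) \in instr p -> n \in N -> is_node x -> b \in E.

Definition cond_W1 (p : production Sigma Gamma) : Prop :=
  forall x : vertex (rhs p), is_wire x -> indeg x <= 1 /\ outdeg x <= 1.

Definition cond_W2 (p : production Sigma Gamma) : Prop :=
  forall s a b x d, (s, a, b, x, d) \in instr p -> ~~ is_wire x.

Definition cond_W3 (p : production Sigma Gamma) : Prop :=
  forall w c d, w \in W ->
    (forall b x b' x', (w, c, b, x, d) \in instr p -> (w, c, b', x', d) \in instr p ->
       b = b' /\ x = x') /\
    (forall b x, (w, c, b, x, d) \in instr p -> b \notin E).

(** The direction of an edge is taken relative to the non-terminal vertex [y],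
    as in the application of productions. *)
Definition dir_edge (D : graph Sigma Gamma) (y : vertex D) (b : Gamma) (d : dir)
    (u : vertex D) : bool :=
  match d with
  | In => (u, b, y) \in edges D
  | Out => (y, b, u) \in edges D
  end.

Definition cond_W4 (p : production Sigma Gamma) : Prop :=
  forall (y : vertex (rhs p)) (w : Sigma) (b : Gamma) (d : dir),
    lab _ y \notin terminals G -> w \in W ->
    (exists2 u : vertex (rhs p), lab _ u = w & dir_edge y b d u) \/
    (exists a, (w, a, b, y, d) \in instr p) ->
    forall q : prod_index G, lhs (prods G q) = lab _ y ->
      exists c z, (w, b, c, z, d) \in instr (prods G q).

End Conditions.

Record B_ESG := BESG {
  grammar : edNCE Sigma Gamma;
  decoding : decoding_family;
  besg_decoding : decoding_system decoding;
  besg_boundary : boundary grammar;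
  besg_terminals : terminals grammar = N :|: W;
  besg_final : final_edges grammar = [set: Gamma];
  besg_N1 : forall p, cond_N1 (prods grammar p);
  besg_N2 : forall p, cond_N2 (prods grammar p);
  besg_W1 : forall p, cond_W1 (prods grammar p);
  besg_W2 : forall p, cond_W2 (prods grammar p);
  besg_W3 : forall p, cond_W3 (prods grammar p);
  besg_W4 : forall p, cond_W4 grammar (prods grammar p) }.

Definition language (B : B_ESG) (H2 : graph Sigma Gamma) : Prop :=
  exists H1 : graph Sigma Gamma,
    [/\ derives (grammar B) (single_graph Gamma (start (grammar B))) H1,
        forall v, lab H1 v \in terminals (grammar B),
        decodes (decoding B) H1 H2 &
        no_encoding_edge H2].

End StringGraphs.

(* Main.v *)
Require Import Defs.
From mathcomp Require Import all_boot.

(** Two properties are preserved by every derivation step and every decoding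
    step: edges between node-vertices carry encoding labels, and a wire-vertex
    has at most one edge in each direction.  In a derivation step no edge is
    attached to a wire-vertex of the right-hand side (W2), while the single edge
    joining a wire-vertex of the host graph to the replaced vertex gives rise to
    at most one new edge (W3).  In a decoding step the interface consists of
    node-vertices, so each wire-vertex keeps the edges it had in the context or
    in the right-hand side.  Once no encoding edge is left, the first property
    says that no edge joins two node-vertices. *)

Set Implicit Arguments.
Unset Strict Implicit.
Unset Printing Implicit Defensive.

Section Degrees.
Variables Sigma Gamma : finType.
Implicit Types H K : graph Sigma Gamma.

(** The degree bounds in pointwise form, for both directions at once: unlike a cardinality, this
    transports directly along maps of graphs. *)
Definition unique_edge H (v : vertex H) (d : dir) : Prop :=
  forall b c u w, dir_edge v b d u -> dir_edge v c d w -> b = c /\ u = w.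

Lemma indeg_le1P H (v : vertex H) : indeg v <= 1 <-> unique_edge v In.
Proof.
split=> [/card_le1_eqP le1 b c u w ub wc|uni].
  by have [] : (w, c, v) = (u, b, v) by apply: le1; rewrite !inE eqxx andbT.
apply/card_le1_eqP => -[[u b] x] [[w c] y]; rewrite !inE /=.
move=> /andP[ub /eqP vx] /andP[wc /eqP vy]; subst x y.
by have [-> ->] := uni _ _ _ _ ub wc.
Qed.

Lemma outdeg_le1P H (v : vertex H) : outdeg v <= 1 <-> unique_edge v Out.
Proof.
split=> [/card_le1_eqP le1 b c u w ub wc|uni].
  by have [] : (v, c, w) = (v, b, u) by apply: le1; rewrite !inE eqxx andbT.
apply/card_le1_eqP => -[[x b] u] [[y c] w]; rewrite !inE /=.
move=> /andP[ub /eqP vx] /andP[wc /eqP vy]; subst x y.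
by have [-> ->] := uni _ _ _ _ ub wc.
Qed.

Lemma dir_edge_mor H K (f : vertex H -> vertex K) v b d u :
  graph_mor f -> dir_edge v b d u -> dir_edge (f v) b d (f u).
Proof. by case: d => -[_ fe] /fe. Qed.

Lemma unique_edge_mono H K (f : vertex H -> vertex K) v d :
  graph_mono f -> unique_edge (f v) d -> unique_edge v d.
Proof.
move=> [fm fi] uni b c u w ub wc.
by have [-> /fi] := uni _ _ _ _ (dir_edge_mor fm ub) (dir_edge_mor fm wc).
Qed.

End Degrees.

Section EncodedStringGraphs.
Variables (Sigma Gamma : finType) (N W : {set Sigma}) (E : {set Gamma}).
Hypothesis NW_disjoint : [disjoint N & W].
Implicit Types H K : graph Sigma Gamma.

Lemma nodeNwire s : s \in N -> s \notin W.
Proof. by move=> sN; rewrite (disjointFr NW_disjoint sN). Qed.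

(* Vertices labelled by non-terminals are allowed, so that this applies to
   sentential forms. *)
Definition encoded_string_form H : Prop :=
  (forall v g w, (v, g, w) \in edges H -> is_node N v -> is_node N w -> g \in E) /\
  (forall (v : vertex H) d, is_wire W v -> unique_edge v d).

Lemma encoded_string_form_single s : encoded_string_form (single_graph Gamma s).
Proof. by split=> [v g w|v [] _ b c u w] /=; rewrite inE. Qed.

(** Both conditions only restrict which edges may be present, so they pass to subgraphs. This serves
    for isomorphic copies and for the context graph of a decoding step. *)
Lemma encoded_string_form_mono H K (f : vertex H -> vertex K) :
  graph_mono f -> encoded_string_form K -> encoded_string_form H.
Proof.
move=> fmono [nodeK wireK]; have [[fl fe] _] := fmono.
split=> [v g w /fe vw vN wN|v d vW].
  by apply: nodeK vw _ _; rewrite /is_node fl.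
by apply: (unique_edge_mono fmono); apply: wireK; rewrite /is_wire fl.
Qed.

Lemma graph_iso_mono H K :
  graph_iso H K -> exists f : vertex K -> vertex H, graph_mono f.
Proof.
case=> f [g fK gK] [fl fe]; exists g; split; last exact: can_inj gK.
by split=> [v|v b w]; rewrite -?fl -?fe !gK.
Qed.

Lemma encoded_string_form_substitute H (v : vertex H) (p : production Sigma Gamma) :
  cond_N1 N E p -> cond_N2 N E p -> cond_W1 W p -> cond_W2 W p -> cond_W3 W E p ->
  encoded_string_form H -> encoded_string_form (substitute v p).
Proof.
move=> N1 N2 W1 W2 W3 [nodeH wireH]; split.
  move=> [w|x] g [u|y]; rewrite inE /= => e xN yN.
  - exact: nodeH e xN yN.
  - by have /existsP[b /andP[_ i]] := e; apply: N2 i xN yN.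
  - by have /existsP[b /andP[_ i]] := e; apply: N2 i yN xN.
  - by rewrite (N1 _ _ _ e); apply/andP.
move=> [w|x] d sW; last first.
  have xW : is_wire W x := sW; have [xin xout] := W1 x xW.
  have uni : unique_edge x d by case: d; [apply/indeg_le1P|apply/outdeg_le1P].
  (* By (W2) no instruction targets a wire-vertex of the right-hand side, so such a vertex gets no
     edge to the host graph. *)
  have noinl b u : dir_edge (D := substitute v p) (inr x) b d (inl u) = false.
    apply/negP; case: d {uni}; rewrite /= inE /= => /existsP[a /andP[_ /W2]];
      by rewrite xW.
  move=> b c [u|u] [y|y]; rewrite ?noinl // => eu ey.
  have [||-> ->] // := uni b c u y.
    by case: d {uni noinl ey} eu; rewrite /= inE.
  by case: d {uni noinl eu} ey; rewrite /= inE.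
have uni := wireH _ d sW.
have old b u : dir_edge (D := substitute v p) (inl w) b d (inl u) ->
    dir_edge (val w) b d (val u).
  by case: d {uni}; rewrite /= inE.
(* Instructions take directions relative to the replaced vertex [v], whereas [dir_edge] here takes
   them relative to [w]. *)
pose flip d := if d is In then Out else In.
have new b x : dir_edge (D := substitute v p) (inl w) b d (inr x) ->
    exists2 a, dir_edge (val w) a d v &
               (lab H (val w), a, b, x, flip d) \in instr p.
  by case: d {uni old}; rewrite /= inE /= => /existsP[a /andP[]]; exists a.
(* In the mixed cases the unique host edge at [w] would end both at [v] and at a surviving vertex.
   Two new edges come from the same host edge, hence from instructions that (W3) identifies. *)
move=> b c [u|x] [y|z].
- move=> /old eu /old ey; have [-> uy] := uni _ _ _ _ eu ey.
  by rewrite (val_inj uy).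
- move=> /old eu /new[a ev _]; have [_ uv] := uni _ _ _ _ eu ev.
  by have := valP u; rewrite /= uv eqxx.
- move=> /new[a ev _] /old ey; have [_ yv] := uni _ _ _ _ ev ey.
  by have := valP y; rewrite /= -yv eqxx.
move=> /new[a ev ib] /new[a' ev' ic].
have [aa' _] := uni _ _ _ _ ev ev'; subst a'.
have [det _] := W3 _ a (flip d) sW.
by have [-> ->] := det _ _ _ _ ib ic.
Qed.

(** An edge of [L] meeting [jK x] would put [x] in the image of the interface, so every edge at
    [jK x] comes from [K]. *)
Lemma unique_edge_pushout I K L H
    (iK : vertex I -> vertex K) (iL : vertex I -> vertex L)
    (jK : vertex K -> vertex H) (jL : vertex L -> vertex H) x d :
  pushout iK iL jK jL -> (forall z, x <> iK z) -> unique_edge x d ->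
  unique_edge (jK x) d.
Proof.
move=> po xI uni.
have [[_ _] jKi] := po_jK po.
have inK b u : dir_edge (jK x) b d u -> exists2 u', u = jK u' & dir_edge x b d u'.
  case: d {uni} => /= /(po_edge po)[] [y [y' [e [ey ey']]]].
  - by exists y => //; rewrite (jKi _ _ ey').
  - by have [z [/xI]] := po_vertex_meet po ey'.
  - by exists y' => //; rewrite (jKi _ _ ey).
  - by have [z [/xI]] := po_vertex_meet po ey.
move=> b c u w /inK[u' -> eu] /inK[w' -> ew].
by have [-> ->] := uni _ _ _ _ eu ew.
Qed.

(** Lets the previous lemma apply also to vertices coming from [L]. *)
Lemma pushout_sym I K L H
    (iK : vertex I -> vertex K) (iL : vertex I -> vertex L)
    (jK : vertex K -> vertex H) (jL : vertex L -> vertex H) :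
  pushout iK iL jK jL -> pushout iL iK jL jK.
Proof.
move=> po; split=> [|||||v|y x /esym e|v g w e|y g y' x x' ey ex exy exy'].
- exact: po_iL po.
- exact: po_iK po.
- exact: po_jL po.
- exact: po_jK po.
- by move=> z; rewrite (po_comm po).
- by case: (po_vertex po v); [right|left].
- by have [z [-> ->]] := po_vertex_meet po e; exists z.
- by case: (po_edge po e); [right|left].
- have [z [z' [? ? ? ? ?]]] := po_edge_meet po ex ey (esym exy) (esym exy').
  by exists z, z'.
Qed.

Lemma encoded_string_form_pushout I K L H
    (iK : vertex I -> vertex K) (iL : vertex I -> vertex L)
    (jK : vertex K -> vertex H) (jL : vertex L -> vertex H) :
  pushout iK iL jK jL -> (forall z : vertex I, is_node N z) ->
  encoded_string_form K -> encoded_string_form L -> encoded_string_form H.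
Proof.
move=> po nodeI [nodeK wireK] [nodeL wireL].
have [[jKl _] _] := po_jK po; have [[jLl _] _] := po_jL po.
have [[iKl _] _] := po_iK po; have [[iLl _] _] := po_iL po.
split.
  move=> v g w /(po_edge po)[] [y [y' [e [-> ->]]]].
    by rewrite /is_node !jKl; apply: nodeK e.
  by rewrite /is_node !jLl; apply: nodeL e.
move=> v d; case: (po_vertex po v) => -[x ->]; rewrite /is_wire (jKl, jLl) => xW.
  apply: (unique_edge_pushout po) => [z xz|]; last exact: wireK.
  by move: xW; apply/negP; rewrite xz iKl; apply/nodeNwire/nodeI.
apply: (unique_edge_pushout (pushout_sym po)) => [z xz|]; last exact: wireL.
by move: xW; apply/negP; rewrite xz iLl; apply/nodeNwire/nodeI.
Qed.

Lemma string_graph_encoded_string_form H :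
  string_graph N W H -> encoded_string_form H.
Proof.
case=> _ node inW outW; split=> [v g w /node|v [] vW].
- by case: is_node => //; case: is_node.
- exact/indeg_le1P/inW.
- exact/outdeg_le1P/outW.
Qed.

Lemma encoded_string_form_string_graph H :
  (forall v, lab H v \in N :|: W) -> no_encoding_edge E H ->
  encoded_string_form H -> string_graph N W H.
Proof.
move=> labH noE [node wire]; split=> // [v g w e|v vW|v vW].
- by apply/negP => /andP[vN wN]; have := noE _ _ _ e; rewrite (node _ _ _ e).
- exact/indeg_le1P/wire.
- exact/outdeg_le1P/wire.
Qed.

Lemma encoded_string_form_derives (B : B_ESG N W E) H K :
  derives (grammar B) H K -> encoded_string_form H -> encoded_string_form K.
Proof.
elim=> {H K} // H K L [p [v [_ iso]]] _ IH formH; apply: IH.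
have [f fmono] := graph_iso_mono iso.
apply: (encoded_string_form_mono fmono).
by apply: encoded_string_form_substitute => //;
   [exact: besg_N1|exact: besg_N2|exact: besg_W1|exact: besg_W2|exact: besg_W3].
Qed.

(** The label condition is carried along because a derivation guarantees terminal labels only before
    decoding starts. *)
Lemma decodes_step_form (T : decoding_family Sigma Gamma) H K :
  decoding_system N W E T -> decodes_step N E T H K ->
  (forall v, lab H v \in N :|: W) -> encoded_string_form H ->
  (forall v, lab K v \in N :|: W) /\ encoded_string_form K.
Proof.
move=> sysT [a [n1 [n2 [aE n1N n2N]]]] [D [m [m' [k [f [f' [poH poK]]]]]]] labH formH.
have [[s [t [st _ sn tn _]]] _ [strR _] _ _] := sysT _ _ _ aE n1N n2N.
(* Interface vertices have the labels of their images in the left-hand side, whose two vertices are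
   labelled [n1] and [n2]. *)
have nodeI (z : vertex (dpo_int (T a n1 n2))) : is_node N z.
  have [[ll _] _] := dpo_l_mono (T a n1 n2).
  by rewrite /is_node -ll; case: (st (dpo_l z)) => ->; rewrite ?sn ?tn.
have formD := encoded_string_form_mono (po_jK poH) formH.
have formR := string_graph_encoded_string_form strR.
split; last exact: encoded_string_form_pushout poK nodeI formD formR.
have [[fl _] _] := po_jK poH.
have [[f'l _] _] := po_jK poK; have [[m'l _] _] := po_jL poK.
move=> v; case: (po_vertex poK v) => -[x ->]; first by rewrite f'l -fl.
by rewrite m'l; case: strR.
Qed.

Lemma decodes_form (T : decoding_family Sigma Gamma) H K :
  decoding_system N W E T -> decodes N E T H K ->
  (forall v, lab H v \in N :|: W) -> encoded_string_form H ->
  (forall v, lab K v \in N :|: W) /\ encoded_string_form K.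
Proof.
move=> sysT; elim=> {H K} // H K L step _ IH labH formH.
by have [labK formK] := decodes_step_form sysT step labH formH; apply: IH.
Qed.

End EncodedStringGraphs.

Theorem theorem1 (Sigma Gamma : finType) (N W : {set Sigma}) (E : {set Gamma})
    (NW_disjoint : [disjoint N & W]) (B : B_ESG N W E) (H : graph Sigma Gamma) :
  language B H -> string_graph N W H.
Proof.
case=> H1 [der labH1 dec noE]; rewrite besg_terminals in labH1.
have form1 := encoded_string_form_derives der (encoded_string_form_single _ _ _ _).
have [labH formH] := decodes_form NW_disjoint (besg_decoding B) dec labH1 form1.
exact: encoded_string_form_string_graph labH noE formH.
Qed.
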